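(* Let $\Omega$ be a $\sigma$-compact metric space, $\nu$ a probability measure on the Borel $\sigma$-field of $\Omega$, $\mathcal{C}\in\mathbb{C}^{I_1\times\cdots\times I_N\times I_1\times\cdots\times I_N}$ a Hermitian tensor and $\tau\mapsto\mathcal{D}_\tau$ a continuous map from $\Omega$ into Hermitian tensors of the same size with $\sup\{\|\mathcal{D}_\tau\|:\tau\in\Omega\}<\infty$, all of Hermitian rank $r$. Then the following are equivalent: (i) $\vec\lambda(\mathcal{C})\prec_w\int_{\Omega^r}\vec\lambda(\mathcal{D}_\tau)\,d\nu^r(\tau)$; (ii) for every non-decreasing convex function $f:\mathbb{R}\to[0,\infty)$ and every unitarily invariant norm $\|\cdot\|_\rho$, $\|f(\mathcal{C})\|_\rho\le\int_\Omega\|f(\mathcal{D}_\tau)\|_\rho\,d\nu(\tau)$.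
   Context: Einstein product, conjugate transpose and Hermitian tensors: $(\mathcal{A}\star_N\mathcal{B})_{i,k}=\sum_j a_{i,j}b_{j,k}$ over multi-indices, $(\mathcal{A}^H)_{j,i}=\overline{a_{i,j}}$. A Hermitian tensor decomposes as $\mathcal{H}=\sum_{i=1}^r\lambda_i\mathcal{U}_i\otimes\mathcal{U}_i^H$ with real Hermitian eigenvalues $\lambda_i$ and orthonormal $\mathcal{U}_i$; $r$ (minimal) is the Hermitian rank; $\vec\lambda(\mathcal{H})=(\lambda_1(\mathcal{H}),\dots,\lambda_r(\mathcal{H}))$ lists them in decreasing order; $f(\mathcal{H})=\sum_i f(\lambda_i)\mathcal{U}_i\otimes\mathcal{U}_i^H$; $|\mathcal{A}|=(\mathcal{A}^H\star_N\mathcal{A})^{1/2}$; $\|\cdot\|$ is the operator norm. Notation: $\int_{\Omega^r}\vec\lambda(\mathcal{D}_\tau)d\nu^r(\tau)=\left(\int_\Omega\lambda_1(\mathcal{D}_\tau)d\nu(\tau),\dots,\int_\Omega\lambda_r(\mathcal{D}_\tau)d\nu(\tau)\right)$. For $\mathbf{x},\mathbf{y}\in\mathbb{R}^r$ with decreasingly ordered entries, $\mathbf{x}\prec_w\mathbf{y}$ means $\sum_{i=1}^kx_i\le\sum_{i=1}^ky_i$ for all $k=1,\dots,r$. A unitarily invariant norm satisfies $\|\mathcal{U}\mathcal{H}\|_\rho=\|\mathcal{H}\mathcal{U}\|_\rho=\|\mathcal{H}\|_\rho$ for unitary $\mathcal{U}$ and $\|\mathcal{H}\|_\rho=\rho(\vec\lambda(|\mathcal{H}|))$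 for a symmetric gauge function $\rho$. *)

(* Defs.v *)
(* MathComp + MathComp-Analysis (+ complex numbers R[i] from mathcomp-real-closed). *)
From HB Require Import structures.
From mathcomp Require Import all_boot all_order all_algebra all_fingroup.
From mathcomp Require Import all_classical all_reals all_analysis.
From mathcomp Require Import complex.

Set Implicit Arguments.
Unset Strict Implicit.
Unset Printing Implicit Defensive.

Import Order.TTheory GRing.Theory Num.Theory.
Import numFieldNormedType.Exports.
Local Open Scope classical_set_scope.
Local Open Scope ring_scope.
Local Open Scope complex_scope.

Section Tensors.
Variables (R : realType) (N : nat) (I : 'I_N -> nat).
Local Notation C := R[i].

(** multi-indices (i_1,...,i_N) with i_k < I_k *)
Definition midx := {dffun forall k : 'I_N, 'I_(I k)}.

(** order-N tensors in C^{I_1 x ... x I_N} *)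
Definition tvec := midx -> C.
(** order-2N tensors in C^{I_1 x ... x I_N x I_1 x ... x I_N} *)
Definition tensor := midx -> midx -> C.

Definition tvec0 : tvec := fun _ => 0.

(** Einstein product *)
Definition einstein (A B : tensor) : tensor :=
  fun i k => \sum_(j : midx) A i j * B j k.

(** conjugate transpose: (A^H)_{j,i} = conj (a_{i,j}) *)
Definition ctr (A : tensor) : tensor := fun j i => (A i j)^*.

Definition herm_tensor (A : tensor) : Prop := forall i j, A i j = ctr A i j.

(** inner product of order-N tensors *)
Definition tdot (U V : tvec) : C := \sum_(i : midx) U i * (V i)^*.

Definition orthonormal (Us : seq tvec) : Prop :=
  forall a b, (a < size Us)%N -> (b < size Us)%N ->
    tdot (nth tvec0 Us a) (nth tvec0 Us b) = (a == b)%:R.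

(** H = sum_i lam_i U_i (x) U_i^H with orthonormal U_i, real lam_i *)
Definition herm_decomp (H : tensor) (lam : seq R) (Us : seq tvec) : Prop :=
  size Us = size lam /\ orthonormal Us /\
  forall i j, H i j = \sum_(k < size lam)
     (nth 0 lam k)%:C * ((nth tvec0 Us k i) * (nth tvec0 Us k j)^*).

(** Hermitian rank: minimal number of terms in such a decomposition *)
Definition hrank (H : tensor) (r : nat) : Prop :=
  (exists lam Us, herm_decomp H lam Us /\ size lam = r) /\
  (forall lam Us, herm_decomp H lam Us -> (r <= size lam)%N).

(** a minimal decomposition with eigenvalues listed in decreasing order *)
Definition hspec_ok (H : tensor) (p : seq R * seq tvec) : Prop :=
  herm_decomp H p.1 p.2 /\ hrank H (size p.1) /\ sorted (fun x y => y <= x) p.1.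

Definition hspec (H : tensor) : seq R * seq tvec :=
  match pselect (exists p, hspec_ok H p) with
  | left e => proj1_sig (cid e)
  | right _ => ([::], [::])
  end.

(** vec lambda (H): Hermitian eigenvalues, decreasing, of length the Hermitian rank *)
Definition hlam (H : tensor) : seq R := (hspec H).1.

(** f(H) = sum_i f(lambda_i) U_i (x) U_i^H *)
Definition tfun (f : R -> R) (H : tensor) : tensor :=
  fun i j => \sum_(k < size (hlam H))
     (f (nth 0 (hlam H) k))%:C *
     ((nth tvec0 (hspec H).2 k i) * (nth tvec0 (hspec H).2 k j)^*).

(** |A| = (A^H * A)^{1/2} *)
Definition tabs (A : tensor) : tensor := tfun Num.sqrt (einstein (ctr A) A).

(** Euclidean (Frobenius) norm of an order-N tensor and operator norm *)
Definition vnorm (x : tvec) : R :=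
  Num.sqrt (\sum_(i : midx) ((complex.Re (x i)) ^+ 2 + (complex.Im (x i)) ^+ 2)).

Definition tapply (A : tensor) (x : tvec) : tvec := fun i => \sum_(j : midx) A i j * x j.

Definition opnorm (A : tensor) : R :=
  sup [set vnorm (tapply A x) | x in [set x : tvec | vnorm x = 1]].

(** dimension of the tensor space C^{I_1 x ... x I_N} *)
Definition ndim : nat := #|{: midx}|.

(** symmetric gauge functions on R^ndim *)
Definition sym_gauge (rho : ('I_ndim -> R) -> R) : Prop :=
  (forall x, 0 <= rho x) /\
  (forall x, rho x = 0 -> forall k, x k = 0) /\
  (forall (a : R) x, rho (fun k => a * x k) = `|a| * rho x) /\
  (forall x y, rho (fun k => x k + y k) <= rho x + rho y) /\
  (forall (s : 'S_ndim) x, rho (fun k => x (s k)) = rho x) /\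
  (forall (eps : 'I_ndim -> R) x, (forall k, eps k = 1 \/ eps k = -1) ->
      rho (fun k => eps k * x k) = rho x).

(** unitarily invariant norm ||A||_rho = rho(vec lambda(|A|)) (padded by zeros) *)
Definition uinorm (rho : ('I_ndim -> R) -> R) (A : tensor) : R :=
  rho (fun k => nth 0 (hlam (tabs A)) k).

End Tensors.

Arguments tvec0 {R N I}.

(** weak majorization x <_w y for decreasingly ordered vectors of equal length *)
Definition wmaj {R : realType} (x y : seq R) : Prop :=
  size x = size y /\
  forall k, (k <= size x)%N ->
    \sum_(i < k) nth 0 x i <= \sum_(i < k) nth 0 y i.

Definition sigma_compact {R : realType} (T : metricType R) : Prop :=
  exists K : nat -> set T, (forall n, compact (K n)) /\ \bigcup_n K n = setT.

(** continuity of a tensor-valued map (entrywise, i.e. w.r.t. any norm) *)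
Definition tcontinuous {R : realType} {N} {I : 'I_N -> nat} (T : topologicalType)
  (D : T -> tensor R I) : Prop :=
  forall i j, continuous (fun t => complex.Re (D t i j)) /\ continuous (fun t => complex.Im (D t i j)).

Definition nondecr_fun {R : realType} (f : R -> R) : Prop :=
  forall x y, x <= y -> f x <= f y.

Definition convex_fun {R : realType} (f : R -> R) : Prop :=
  forall x y (t : R), 0 <= t <= 1 -> f (t * x + (1 - t) * y) <= t * f x + (1 - t) * f y.

(** metric spaces with a distinguished point (needed to form the Borel
    sigma-algebra type [g_sigma_algebraType]; a space carrying a probability
    measure is nonempty anyway) *)
#[short(type="pmetricType")]
HB.structure Definition PointedMetric (K : numDomainType) :=
  { M of Metric K M & isPointed M }.

(* Main.v *)
(** The norm of [f(H)] is [rho (f l_1, ..., f l_r, 0, ...)], where the [l_i] are the nonzero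
    eigenvalues of [H].

    (i) => (ii).  Let [x] be the spectrum of [C] and [y] the mean spectrum of [D].  By
    Hahn-Banach and the symmetry of the gauge there is a nonnegative decreasing [phi] with
    [phi . z <= rho z] for all [z] and [rho (f x) <= phi . f x].  If [c] is a subgradient of
    [f], then [w_i = phi_i c(x_i)] is nonnegative and decreasing and
    [rho (f (l(D_t))) >= rho (f x) + sum_i w_i (l_i(D_t) - x_i)].  The integral of the last sum
    is [sum_i w_i (y_i - x_i)], which is nonnegative by Abel summation and the majorization.

    (ii) => (i).  For [c] large, take [f x = max (x + c) 0] and the Ky Fan gauges.

    Measurability of the eigenvalues: the number of eigenvalues above [a >= 0] is lower
    semicontinuous in the tensor, hence so is the positive part of each eigenvalue; as the
    rank is constant, the negative parts are handled by passing to [- D]. *)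

Require Import Defs.
From HB Require Import structures.
From mathcomp Require Import all_boot all_order all_algebra all_fingroup.
From mathcomp Require Import all_classical all_reals all_analysis.
From mathcomp Require Import complex.
From mathcomp Require Import measurable_realfun ring lra.

Set Implicit Arguments.
Unset Strict Implicit.
Unset Printing Implicit Defensive.

Import Order.TTheory GRing.Theory Num.Theory.
Import numFieldNormedType.Exports.
Local Open Scope classical_set_scope.
Local Open Scope ring_scope.

(** * Convexity, majorization and gauges *)

(** The functional is extended from the line of [v] one coordinate at a time. The invariant [ext]
    ranges over pairs [(a, x)] instead of vectors [a v + x], so [v] may depend linearly on the
    coordinate vectors already treated. *)
Lemma hahn_banach_coord (R : realType) (n : nat) (rho : ('I_n -> R) -> R)
    (v : 'I_n -> R) :
  (forall a x, rho (fun k => a * x k) = `|a| * rho x) ->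
  (forall x y, rho (fun k => x k + y k) <= rho x + rho y) ->
  exists phi : 'I_n -> R,
    \sum_k phi k * v k = rho v /\ forall x, \sum_k phi k * x k <= rho x.
Proof.
move=> rhoZ rhoD.
have ext m : (m <= n)%N -> exists phi : 'I_n -> R, forall a x,
    (forall k : 'I_n, (m <= k)%N -> x k = 0) ->
    a * rho v + \sum_k phi k * x k <= rho (fun k => a * v k + x k).
  elim: m => [_|m IHm lt_mn].
    exists (fun=> 0) => a x x0.
    rewrite big1 ?addr0 => [|k _]; last by rewrite mul0r.
    have -> : (fun k => a * v k + x k) = (fun k => a * v k).
      by apply/funext => k; rewrite x0 // addr0.
    have rho_ge0 : 0 <= rho v.
      have := rhoD v (fun k => -1 * v k).
      have -> : (fun k => v k + -1 * v k) = (fun k => 0 * v k).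
        by apply/funext => k; ring.
      by rewrite !rhoZ normr0 mul0r normrN1 mul1r; lra.
    by rewrite rhoZ ler_wpM2r // ler_norm.
  have [phi IHphi] := IHm (ltnW lt_mn).
  pose j := Ordinal lt_mn.
  pose e (k : 'I_n) : R := (k == j)%:R.
  (* [S] collects the lower bounds for the value at the new vector [e]; by subadditivity they lie
     below the upper bounds of [ubS], so the supremum is admissible. *)
  pose S := [set s : R | exists a x, (forall k : 'I_n, (m <= k)%N -> x k = 0) /\
    s = a * rho v + \sum_k phi k * x k - rho (fun k => a * v k + x k - e k)].
  have ubS a x : (forall k : 'I_n, (m <= k)%N -> x k = 0) ->
      ubound S (rho (fun k => a * v k + x k + e k)
                - a * rho v - \sum_k phi k * x k).
    move=> x0 _ [a' [x' [x'0 ->]]].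
    have := IHphi (a + a') (fun k => x k + x' k).
    have -> : \sum_k phi k * (x k + x' k)
            = \sum_k phi k * x k + \sum_k phi k * x' k.
      by rewrite -big_split; apply: eq_bigr => k _; rewrite mulrDr.
    move=> /(_ _)/[dup] H.
    have {}H := H (fun k mk => etrans (congr2 +%R (x0 k mk) (x'0 k mk)) (addr0 0)).
    have := rhoD (fun k => a * v k + x k + e k) (fun k => a' * v k + x' k - e k).
    have -> : (fun k => a * v k + x k + e k + (a' * v k + x' k - e k))
            = (fun k => (a + a') * v k + (x k + x' k)).
      by apply/funext => k; ring.
    by lra.
  pose x0 (k : 'I_n) : R := 0.
  have x00 (k : 'I_n) : (m <= k)%N -> x0 k = 0 by [].
  have supS : has_sup S.
    split; last by exists (rho (fun k => 0 * v k + x0 k + e k)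
                - 0 * rho v - \sum_k phi k * x0 k); exact: ubS.
    by exists (0 * rho v + \sum_k phi k * x0 k
           - rho (fun k => 0 * v k + x0 k - e k)), 0, x0.
  pose b := sup S.
  have b1 a x : (forall k : 'I_n, (m <= k)%N -> x k = 0) ->
      a * rho v + \sum_k phi k * x k - rho (fun k => a * v k + x k - e k) <= b.
    by move=> xm; apply: sup_upper_bound => //; exists a, x.
  have b2 a x : (forall k : 'I_n, (m <= k)%N -> x k = 0) ->
      b <= rho (fun k => a * v k + x k + e k)
                - a * rho v - \sum_k phi k * x k.
    by move=> xm; apply: ge_sup; [exact: supS.1 | exact: ubS].
  exists (fun k => if k == j then b else phi k) => a x xm.
  pose y (k : 'I_n) : R := if k == j then 0 else x k.
  have ym (k : 'I_n) : (m <= k)%N -> y k = 0.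
    rewrite leq_eqVlt /y => /orP[/eqP mk|/xm ->]; last by case: ifP.
    by rewrite ifT //; apply/eqP/val_inj.
  have xE k : x k = y k + x j * e k.
    by rewrite /y /e; case: eqP => [->|_]; rewrite ?mulr1 ?mulr0 ?add0r ?addr0.
  have -> : \sum_k (if k == j then b else phi k) * x k
          = \sum_k phi k * y k + b * x j.
    rewrite -(big_pred1_eq +%R j (fun=> b * x j)) [\sum_(i | i == j) _]big_mkcond.
    rewrite -big_split; apply: eq_bigr => k _ /=; rewrite /y.
    by case: eqP => [->|_]; rewrite ?mulr0 ?add0r ?addr0.
  have sumZ (c : R) : \sum_k phi k * (c * y k) = c * \sum_k phi k * y k.
    by rewrite mulr_sumr; apply: eq_bigr => k _; ring.
  (* By homogeneity a nonzero coefficient of [e] is scaled to -1 or 1, the cases of [b1] and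
     [b2]. *)
  have [xj0|xj0|xj0] := ltgtP (x j) 0.
  - pose c := - x j; have c0 : 0 < c by rewrite /c; lra.
    have := b1 (c^-1 * a) (fun k => c^-1 * y k) (fun k mk => etrans (congr1 _ (ym k mk)) (mulr0 _)).
    have -> : (fun k => c^-1 * a * v k + c^-1 * y k - e k)
        = (fun k => c^-1 * (a * v k + x k)).
      apply/funext => k; rewrite (xE k) !mulrDr mulrA -[x j]opprK -/c.
      by field; rewrite gt_eqF.
    rewrite rhoZ sumZ gtr0_norm ?invr_gt0 // -(ler_pM2l c0).
    rewrite mulrBr mulrDr !mulrA divff ?gt_eqF // !mul1r /c; lra.
  - have := b2 ((x j)^-1 * a) (fun k => (x j)^-1 * y k)
      (fun k mk => etrans (congr1 _ (ym k mk)) (mulr0 _)).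
    have -> : (fun k => (x j)^-1 * a * v k + (x j)^-1 * y k + e k)
        = (fun k => (x j)^-1 * (a * v k + x k)).
      apply/funext => k; rewrite (xE k) !mulrDr mulrA.
      by field; rewrite gt_eqF.
    rewrite rhoZ sumZ gtr0_norm ?invr_gt0 // -(ler_pM2l xj0).
    rewrite !mulrBr !mulrA divff ?gt_eqF // !mul1r; lra.
  - rewrite xj0 mulr0 addr0.
    have -> : (fun k => a * v k + x k) = (fun k => a * v k + y k).
      by apply/funext => k; rewrite (xE k) xj0; ring.
    exact: IHphi.
have [phi Hphi] := ext n (leqnn n).
have phi_le x : \sum_k phi k * x k <= rho x.
  have := Hphi 0 x; rewrite mul0r add0r.
  have -> : (fun k => 0 * v k + x k) = x by apply/funext => k; ring.
  by apply=> k; rewrite leqNgt ltn_ord.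
exists phi; split=> //; apply/eqP; rewrite eq_le phi_le /=.
(* With [a = 1] and [x = - v] the right side is [rho 0], which gives the reverse inequality. *)
have := Hphi 1 (fun k => -1 * v k).
have -> : (fun k => 1 * v k + -1 * v k) = (fun k => 0 * v k).
  by apply/funext => k; ring.
rewrite rhoZ normr0 mul0r mul1r.
have -> : \sum_k phi k * (-1 * v k) = - \sum_k phi k * v k.
  by rewrite -sumrN; apply: eq_bigr => k _; ring.
move=> /(_ _)/[dup] H.
have {}H : rho v - \sum_k phi k * v k <= 0.
  by apply: H => k; rewrite leqNgt ltn_ord.
lra.
Qed.

(** [c x] is the left derivative, the supremum of the slopes to the left of [x]; convexity puts each
    of these below each slope to the right. *)
Lemma convex_subgradient (R : realType) (f : R -> R) : convex_fun f ->
  exists c : R -> R, forall x y, f x + c x * (y - x) <= f y.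
Proof.
move=> cf.
suff: forall x, exists c, forall y, f x + c * (y - x) <= f y
  by move=> /choice[c Hc]; exists c.
move=> x.
have slope y z : y < x -> x < z -> (f x - f y) * (z - x) <= (f z - f x) * (x - y).
  move=> yx xz.
  have yz : 0 < z - y by lra.
  have := cf y z ((z - x) / (z - y)).
  have -> : (z - x) / (z - y) * y + (1 - (z - x) / (z - y)) * z = x.
    by field; rewrite gt_eqF.
  have -> : 0 <= (z - x) / (z - y) <= 1.
    by rewrite divr_ge0 /= ?ler_pdivrMr //; lra.
  move=> /(_ isT); rewrite -(ler_pM2r yz).
  have -> : ((z - x) / (z - y) * f y + (1 - (z - x) / (z - y)) * f z) * (z - y)
      = (z - x) * f y + (x - y) * f z by field; rewrite gt_eqF.
  lra.
pose S := [set s : R | exists y, y < x /\ s = (f x - f y) / (x - y)].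
have ubS z : x < z -> ubound S ((f z - f x) / (z - x)).
  move=> xz _ [y [yx ->]]; rewrite ler_pdivrMr ?subr_gt0 //.
  by rewrite mulrAC ler_pdivlMr ?subr_gt0 // slope.
have supS : has_sup S.
  split; first by exists ((f x - f (x - 1)) / (x - (x - 1))), (x - 1); split=> //; lra.
  by exists ((f (x + 1) - f x) / (x + 1 - x)); apply: ubS; lra.
exists (sup S) => y; have [yx|xy|->] := ltgtP y x; last by rewrite subrr mulr0 addr0.
- have : (f x - f y) / (x - y) <= sup S by apply: sup_upper_bound => //; exists y.
  by rewrite ler_pdivrMr ?subr_gt0 //; lra.
- have : sup S <= (f y - f x) / (y - x) by apply: ge_sup; [exact: supS.1 | exact: ubS].
  by rewrite ler_pdivlMr ?subr_gt0 //; lra.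
Qed.

(** Abel summation by induction: the last weight times the full sum of [d] bounds the weighted sum
    from below. A smaller last weight only lowers this bound, since the partial sums are
    nonnegative. *)
Lemma abel_sum_ge0 (R : realType) (n : nat) (w : 'I_n -> R) (d : nat -> R) :
  (forall i, 0 <= w i) -> (forall i j : 'I_n, (i <= j)%N -> w j <= w i) ->
  (forall k, (k <= n)%N -> 0 <= \sum_(i < k) d i) ->
  0 <= \sum_(i < n) w i * d i.
Proof.
case: n w => [|n] w w0 wdec dsum; first by rewrite big_ord0.
suff: w ord_max * \sum_(i < n.+1) d i <= \sum_(i < n.+1) w i * d i.
  by apply: le_trans; rewrite mulr_ge0 ?dsum.
elim: n w w0 wdec dsum => [|n IHn] w w0 wdec dsum.
  by rewrite !big_ord1 (_ : ord0 = ord_max) //; apply/val_inj.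
rewrite big_ord_recr [X in _ <= X]big_ord_recr /= mulrDr lerD2r.
have {}IHn : w (widen_ord (leqnSn n.+1) ord_max) * \sum_(i < n.+1) d i
    <= \sum_(i < n.+1) w (widen_ord (leqnSn n.+1) i) * d i.
  apply: (IHn (fun i => w (widen_ord (leqnSn n.+1) i))) => [i|i j ij|k kn].
  - exact: w0.
  - exact: wdec.
  - exact/dsum/leqW.
apply: le_trans IHn; apply: ler_wpM2r; first exact: dsum.
by apply: wdec => /=.
Qed.

Lemma sum_tperm (R : realType) (n : nat) (a b : 'I_n -> R) (i j : 'I_n) :
  i != j ->
  \sum_k a (tperm i j k) * b k
  = \sum_k a k * b k + (a j - a i) * (b i - b j).
Proof.
move=> ij; rewrite (bigD1 i) //= (bigD1 j) /=; last by rewrite eq_sym.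
rewrite [X in _ = X + _](bigD1 i) //= [X in _ = _ + X + _](bigD1 j) /=; last by rewrite eq_sym.
rewrite tpermL tpermR (eq_bigr (fun k => a k * b k)); first by ring.
by move=> k /andP[ki kj]; rewrite tpermD // eq_sym.
Qed.

(** Among the permutations that do not lower the pairing with [v], a maximizer of [M2] has no
    inversion: swapping one would keep the first property and strictly increase [M2]. *)
Lemma exists_decreasing_perm (R : realType) (n : nat) (psi v : 'I_n -> R) :
  (forall i j : 'I_n, (i <= j)%N -> v j <= v i) ->
  exists s : 'S_n,
    (forall i j : 'I_n, (i <= j)%N -> psi (s j) <= psi (s i)) /\
    \sum_i psi i * v i <= \sum_i psi (s i) * v i.
Proof.
move=> vdec.
pose M1 (s : 'S_n) := \sum_i psi (s i) * v i.
(* The strictly decreasing weights break the ties of [v]. *)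
pose M2 (s : 'S_n) := \sum_(i < n) psi (s i) * - (i%:R : R).
have P1 : M1 1%g <= M1 1%g by [].
case: (@arg_maxP _ _ _ 1%g (fun s => M1 1%g <= M1 s) M2 P1) => s Ps maxs.
exists s; split; last first.
  by move: Ps; rewrite /M1; under eq_bigr do rewrite perm1.
move=> i j; rewrite leq_eqVlt => /orP[/eqP/val_inj ->//|ij].
rewrite leNgt; apply/negP => lt_psi.
have ij_neq : i != j by apply: contraTneq ij => ->; rewrite ltnn.
have P' : M1 1%g <= M1 (tperm i j * s)%g.
  apply: (le_trans Ps); rewrite /M1.
  under [X in _ <= X]eq_bigr do rewrite permM.
  rewrite (@sum_tperm _ _ (fun k => psi (s k))) // lerDl mulr_ge0 ?subr_ge0 //.
    exact: ltW.
  exact/vdec/ltnW.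
have := maxs _ P'; rewrite /= /M2.
under eq_bigr do rewrite permM.
rewrite (@sum_tperm _ _ (fun k => psi (s k))) // gerDl.
apply/negP; rewrite -ltNge mulr_gt0 ?subr_gt0 // ltrN2 ltr_nat //.
Qed.

(** The norming functional of [v] is replaced by its absolute values in decreasing order. The
    pairing with [v] does not drop, as [v] is nonnegative and decreasing, and the symmetries of
    [rho] preserve the upper bound. *)
Lemma gauge_decreasing_support (R : realType) (n : nat) (rho : ('I_n -> R) -> R)
    (v : 'I_n -> R) :
  (forall a x, rho (fun k => a * x k) = `|a| * rho x) ->
  (forall x y, rho (fun k => x k + y k) <= rho x + rho y) ->
  (forall (s : 'S_n) x, rho (fun k => x (s k)) = rho x) ->
  (forall (eps : 'I_n -> R) x, (forall k, eps k = 1 \/ eps k = -1) ->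
      rho (fun k => eps k * x k) = rho x) ->
  (forall k, 0 <= v k) ->
  (forall i j : 'I_n, (i <= j)%N -> v j <= v i) ->
  exists phi : 'I_n -> R, [/\ forall k, 0 <= phi k,
    forall i j : 'I_n, (i <= j)%N -> phi j <= phi i,
    rho v <= \sum_k phi k * v k & forall x, \sum_k phi k * x k <= rho x].
Proof.
move=> rhoZ rhoD rhoS rhoE v0 vdec.
have [phi [phiv phi_le]] := hahn_banach_coord v rhoZ rhoD.
have [s [sdec sle]] := exists_decreasing_perm (fun k => `|phi k|) vdec.
exists (fun k => `|phi (s k)|); split=> //.
  rewrite -phiv; apply: le_trans sle; apply: ler_sum => k _.
  by rewrite ler_wpM2r // ler_norm.
(* The signs of [phi] and the inverse of [s] are moved onto [x], so that the bound for the original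
   functional applies. *)
move=> x; pose eps k : R := if 0 <= phi k then 1 else -1.
have epsE k : eps k = 1 \/ eps k = -1 by rewrite /eps; case: ifP; [left|right].
rewrite -(rhoS (s^-1)%g) -(rhoE eps) //; apply: le_trans (phi_le _).
rewrite (reindex_inj (@perm_inj _ (s^-1)%g)) /=.
apply: ler_sum => k _; rewrite permKV mulrA le_eqVlt; apply/orP; left.
apply/eqP; congr (_ * _); rewrite /eps; case: ifP => [/ger0_norm ->|]; first by rewrite mulr1.
by move=> /negbT; rewrite -ltNge => /ltr0_norm ->; rewrite mulrN1.
Qed.

(** The Ky Fan norm, that is, the sum of the [k] largest absolute values. The maximum over
    permutations avoids sorting and makes symmetry a change of index. *)
Definition kyfan (R : realType) (n k : nat) (x : 'I_n -> R) : R :=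
  \big[Num.max/0]_(s : 'S_n) \sum_(i < n | (i < k)%N) `|x (s i)|.

Lemma le_kyfan (R : realType) (n k : nat) (x : 'I_n -> R) (s : 'S_n) :
  \sum_(i < n | (i < k)%N) `|x (s i)| <= kyfan k x.
Proof. exact: (le_bigmax _ (fun s : 'S_n => \sum_(i < n | (i < k)%N) `|x (s i)|)). Qed.

Lemma kyfan_ge0 (R : realType) (n k : nat) (x : 'I_n -> R) : 0 <= kyfan k x.
Proof. exact: bigmax_ge_id. Qed.

Lemma kyfan_le (R : realType) (n k : nat) (x : 'I_n -> R) (b : R) : 0 <= b ->
  (forall s : 'S_n, \sum_(i < n | (i < k)%N) `|x (s i)| <= b) -> kyfan k x <= b.
Proof. by move=> b0 H; apply: bigmax_le. Qed.

Lemma kyfan_decreasing (R : realType) (n k : nat) (x : 'I_n -> R) :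
  (forall i, 0 <= x i) -> (forall i j : 'I_n, (i <= j)%N -> x j <= x i) ->
  kyfan k x = \sum_(i < n | (i < k)%N) x i.
Proof.
move=> x0 xdec; apply/eqP; rewrite eq_le; apply/andP; split; last first.
  apply: le_trans (le_kyfan k x 1%g); apply: ler_sum => i _.
  by rewrite perm1 ler_norm.
apply: kyfan_le => [|s]; first by apply: sumr_ge0.
under eq_bigr do rewrite ger0_norm //.
(* For [k >= n] every entry is counted, and there is no entry of index [k] to serve as threshold. *)
have [kn|nk] := ltnP k n; last first.
  have kT (i : 'I_n) : (i < k)%N by apply: leq_trans nk.
  rewrite (eq_bigl xpredT) // [X in _ <= X](eq_bigl xpredT) //.
  by rewrite [X in _ <= X](reindex_inj (@perm_inj _ s)).
(* With the threshold [th], the excess over [th] is positive only on the first [k] entries. *)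
pose th := x (Ordinal kn).
have excess y : \sum_(i < n | (i < k)%N) y i
    = \sum_(i < n | (i < k)%N) (y i - th) + \sum_(i < n | (i < k)%N) th.
  by rewrite -big_split; apply: eq_bigr => i _ /=; rewrite subrK.
rewrite excess [X in _ <= X]excess lerD2r.
apply: (@le_trans _ _ (\sum_(i < n) Num.max (x (s i) - th) 0)).
  rewrite big_mkcond; apply: ler_sum => i _.
  by case: ifP => _; rewrite le_max lexx ?orbT.
rewrite (_ : \sum_i _ = \sum_i Num.max (x i - th) 0); last first.
  by rewrite [RHS](reindex_inj (@perm_inj _ s)).
rewrite [X in _ <= X]big_mkcond; apply: ler_sum => i _.
case: ifP => [ik|/negbT]; first by rewrite max_l // subr_ge0; apply/xdec/ltnW.
by rewrite -leqNgt => ki; rewrite max_r // subr_le0; apply: xdec.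
Qed.

Lemma kyfan_eq0 (R : realType) (n k : nat) (x : 'I_n -> R) : (0 < k)%N ->
  kyfan k x = 0 -> forall i, x i = 0.
Proof.
move=> k0 x0 i; apply/eqP; rewrite -normr_le0 -x0.
have n0 : (0 < n)%N by case: n i {x x0} => [[]|].
apply: le_trans (le_kyfan k x (tperm (Ordinal n0) i)).
by rewrite (bigD1 (Ordinal n0)) //= tpermL lerDl sumr_ge0.
Qed.

Lemma kyfanZ (R : realType) (n k : nat) (a : R) (x : 'I_n -> R) :
  kyfan k (fun i => a * x i) = `|a| * kyfan k x.
Proof.
have le b (y : 'I_n -> R) : kyfan k (fun i => b * y i) <= `|b| * kyfan k y.
  apply: kyfan_le => [|s]; first by rewrite mulr_ge0 ?kyfan_ge0.
  under eq_bigr do rewrite normrM.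
  by rewrite -mulr_sumr ler_wpM2l // le_kyfan.
apply/eqP; rewrite eq_le le /=.
have [->|a0] := eqVneq a 0; first by rewrite normr0 mul0r kyfan_ge0.
rewrite -ler_pdivlMl ?normr_gt0 // -normfV.
apply: le_trans (le a^-1 (fun i => a * x i)); rewrite (_ : (fun _ => _) = x) //.
by apply/funext => i; rewrite mulKf.
Qed.

Lemma kyfanD (R : realType) (n k : nat) (x y : 'I_n -> R) :
  kyfan k (fun i => x i + y i) <= kyfan k x + kyfan k y.
Proof.
apply: kyfan_le => [|s]; first by rewrite addr_ge0 ?kyfan_ge0.
apply: le_trans (lerD (le_kyfan k x s) (le_kyfan k y s)).
by rewrite -big_split; apply: ler_sum => i _; apply: ler_normD.
Qed.

Lemma kyfan_perm (R : realType) (n k : nat) (s : 'S_n) (x : 'I_n -> R) :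
  kyfan k (fun i => x (s i)) = kyfan k x.
Proof.
have le (u : 'S_n) (y : 'I_n -> R) : kyfan k (fun i => y (u i)) <= kyfan k y.
  apply: kyfan_le => [|v]; first exact: kyfan_ge0.
  by under eq_bigr do rewrite -permM; apply: le_kyfan.
apply/eqP; rewrite eq_le le /=.
apply: le_trans (le (s^-1)%g (fun i => x (s i))).
by rewrite (_ : (fun _ => _) = x) //; apply/funext => i; rewrite permKV.
Qed.

Lemma kyfan_sign (R : realType) (n k : nat) (eps x : 'I_n -> R) :
  (forall i, eps i = 1 \/ eps i = -1) -> kyfan k (fun i => eps i * x i) = kyfan k x.
Proof.
move=> epsE; apply: eq_bigr => s _; apply: eq_bigr => i _.
by rewrite normrM; case: (epsE (s i)) => ->; rewrite ?normrN1 ?normr1 mul1r.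
Qed.

(** * Hermitian decompositions *)

(** More unknowns than equations leave a nonzero solution. The subsets [P] and [Q] allow
    eigenvectors to be selected by their eigenvalues; [c] is extended by zero outside [P]. *)
Lemma kernel_vector (F : fieldType) (J L : finType) (P : {set J}) (Q : {set L})
    (M : J -> L -> F) : (#|Q| < #|P|)%N ->
  exists c : J -> F, [/\ exists j, c j != 0, forall j, j \notin P -> c j = 0 &
    forall l, l \in Q -> \sum_j c j * M j l = 0].
Proof.
move=> QP; pose A := \matrix_(i < #|P|, l < #|Q|) M (enum_val i) (enum_val l).
have kerA : kermx A != 0.
  by rewrite kermx_eq0 /row_free neq_ltn (leq_ltn_trans (rank_leq_col A) QP).
have [i ui] : exists i, row i (kermx A) != 0.
  by apply/existsP; rewrite -negb_forall; apply: contraNN kerA =>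
    /forallP u0; apply/eqP/row_matrixP => i; rewrite row0; apply/eqP.
have {ui} [u u0 uA] : exists2 u : 'rV_#|P|, u != 0 & u *m A = 0.
  by exists (row i (kermx A)) => //; rewrite -row_mul mulmx_ker row0.
pose c j := \sum_(k < #|P|) u 0 k * (enum_val k == j)%:R.
have cE k : c (enum_val k) = u 0 k.
  rewrite /c (bigD1 k) //= eqxx mulr1 big1 ?addr0 // => k' k'k.
  by rewrite (inj_eq enum_val_inj) (negPf k'k) mulr0.
have cP j : j \notin P -> c j = 0.
  move=> jP; apply: big1 => k _; case: eqP => [kj|_]; last by rewrite mulr0.
  by rewrite -kj enum_valP in jP.
exists c; split=> // [|l lQ].
  have /rV0Pn[k uk] := u0.
  by exists (enum_val k); rewrite cE.
rewrite (bigID (mem P)) /= [X in _ + X]big1 ?addr0; last first.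
  by move=> j /cP ->; rewrite mul0r.
rewrite big_enum_val /=; have /matrixP/(_ 0 (enum_rank_in lQ l)) := uA.
rewrite !mxE => uAl; rewrite -[RHS]uAl; apply: eq_bigr => k _.
by rewrite cE mxE enum_rankK_in.
Qed.

Lemma card_set_nth (T : Type) (x0 : T) (p : pred T) (s : seq T) :
  #|[set k : 'I_(size s) | p (nth x0 s k)]%SET| = count p s.
Proof.
by rewrite cardsE -sum1_card -sum1_count (big_nth x0) big_mkord.
Qed.

(** * Quadratic forms and uniqueness of the nonzero spectrum *)

Section Spectrum.
Local Open Scope complex_scope.
Variables (R : realType) (N : nat) (I : 'I_N -> nat).
Implicit Types (H K : tensor R I) (lam mu : seq R) (Us Vs : seq (tvec R I)).
Implicit Types (x y : tvec R I).

(* [_^*] may denote [Num.conj] or [conjc] according to the open scopes. *)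
Lemma conjE (z : R[i]) : Num.conj z = conjc z.
Proof. by []. Qed.

Lemma conjcM (z w : R[i]) : conjc (z * w) = conjc z * conjc w.
Proof. exact: (rmorphM (@conjc R)). Qed.

Definition csq (z : R[i]) : R := complex.Re z ^+ 2 + complex.Im z ^+ 2.

Lemma csqE z : (csq z)%:C = z * z^*.
Proof.
case: z => a b; apply/eqP; rewrite eq_complex /csq /=.
by apply/andP; split; apply/eqP; ring.
Qed.

Lemma csq_ge0 z : 0 <= csq z.
Proof. by rewrite /csq addr_ge0 ?sqr_ge0. Qed.

Lemma csq_gt0 z : z != 0 -> 0 < csq z.
Proof.
move=> z0; rewrite lt_neqAle csq_ge0 andbT eq_sym; apply: contraNneq z0.
move/(congr1 (real_complex R)); rewrite csqE => /eqP.
by rewrite mulf_eq0 conjc_eq0 orbb.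
Qed.

Definition sqn x : R := \sum_(i : midx I) csq (x i).

Lemma sqn_ge0 x : 0 <= sqn x.
Proof. by apply: sumr_ge0 => i _; apply: csq_ge0. Qed.

Lemma tdotxx x : tdot x x = (sqn x)%:C.
Proof. by rewrite rmorph_sum; apply: eq_bigr => i _; rewrite /= csqE. Qed.

Lemma tdotC x y : tdot x y = (tdot y x)^*.
Proof.
rewrite /tdot rmorph_sum; apply: eq_bigr => i _.
by rewrite rmorphM /= conjcK mulrC.
Qed.

Definition tcomb (J : finType) (c : J -> R[i]) (u : J -> tvec R I) : tvec R I :=
  fun i => \sum_j c j * u j i.

Lemma tdot_comb (J : finType) (c : J -> R[i]) (u : J -> tvec R I) y :
  tdot (tcomb c u) y = \sum_j c j * tdot (u j) y.
Proof.
rewrite /tdot /tcomb; under eq_bigr do rewrite mulr_suml.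
rewrite exchange_big; apply: eq_bigr => j _; rewrite mulr_sumr.
by apply: eq_bigr => i _; rewrite mulrA.
Qed.

Lemma tdotBl x y z : tdot (fun i => x i - y i) z = tdot x z - tdot y z.
Proof. by rewrite /tdot -sumrB; apply: eq_bigr => i _; rewrite mulrBl. Qed.

Definition orthofam (J : finType) (u : J -> tvec R I) :=
  forall a b, tdot (u a) (u b) = (a == b)%:R.

Lemma tdot_comb_ortho (J : finType) (c : J -> R[i]) (u : J -> tvec R I) k :
  orthofam u -> tdot (tcomb c u) (u k) = c k.
Proof.
move=> ou; rewrite tdot_comb (bigD1 k) //= ou eqxx mulr1 big1 ?addr0 // => j jk.
by rewrite ou (negPf jk) mulr0.
Qed.

Lemma sqn_comb (J : finType) (c : J -> R[i]) (u : J -> tvec R I) :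
  orthofam u -> sqn (tcomb c u) = \sum_j csq (c j).
Proof.
move=> ou; apply: (@complexI R); rewrite -tdotxx tdot_comb rmorph_sum.
apply: eq_bigr => j _; rewrite /= csqE; congr (_ * _).
by rewrite tdotC tdot_comb_ortho.
Qed.

(** [y] is the orthogonal projection of [x], and Pythagoras turns the difference of the two sides
    into the squared norm of [x - y]. *)
Lemma bessel (J : finType) (u : J -> tvec R I) x :
  orthofam u -> \sum_j csq (tdot x (u j)) <= sqn x.
Proof.
move=> ou; pose c j := tdot x (u j); pose y := tcomb c u.
have xy : tdot x y = (sqn y)%:C.
  rewrite tdotC tdot_comb (sqn_comb _ ou) !rmorph_sum; apply: eq_bigr => j _.
  by rewrite rmorphM /= csqE -(tdotC x) mulrC.
suff : sqn (fun i => x i - y i) = sqn x - sqn y.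
  by rewrite -subr_ge0 -(sqn_comb _ ou) => <-; apply: sqn_ge0.
apply: (@complexI R); rewrite -tdotxx tdotBl [tdot x _]tdotC [tdot y _]tdotC.
rewrite !tdotBl [tdot y x]tdotC xy !tdotxx conjc_real subrr conjc0 subr0.
by rewrite -(rmorphB (real_complex R)) conjc_real.
Qed.

Definition qform H x : R[i] := \sum_i \sum_j (x i)^* * H i j * x j.

Lemma qform_decomp H lam Us x : herm_decomp H lam Us ->
  qform H x
  = (\sum_(k < size lam) nth 0 lam k * csq (tdot x (nth tvec0 Us k)))%:C.
Proof.
case=> _ [_ HE]; rewrite rmorph_sum /=.
transitivity (\sum_(k < size lam) \sum_i \sum_j
   (nth 0 lam k)%:C * ((x j * (nth tvec0 Us k j)^*) *
                       ((x i)^* * nth tvec0 Us k i))).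
  rewrite /qform [RHS]exchange_big /=; apply: eq_bigr => i _.
  rewrite [RHS]exchange_big /=; apply: eq_bigr => j _.
  rewrite HE mulr_sumr mulr_suml; apply: eq_bigr => k _; ring.
apply: eq_bigr => k _; rewrite rmorphM /= csqE /tdot (rmorph_sum (@conjc R)) mulr_sumr mulr_sumr.
apply: eq_bigr => i _; rewrite mulr_suml mulr_sumr; apply: eq_bigr => j _.
by rewrite rmorphM /= conjcK.
Qed.

Lemma orthofam_nth Us n : Defs.orthonormal Us -> n = size Us ->
  orthofam (fun k : 'I_n => nth tvec0 Us k).
Proof. by move=> oU -> a b; rewrite oU. Qed.

(** A longer family would have a nontrivial vanishing combination, and pairing it with a member
    recovers the coefficient. Hence padding a spectrum to length [ndim I] loses no eigenvalue. *)
Lemma orthonormal_size Us : Defs.orthonormal Us -> (size Us <= ndim I)%N.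
Proof.
move=> oU; rewrite leqNgt; apply/negP => lt_size.
have := @kernel_vector _ 'I_(size Us) (midx I) [set: _]%SET [set: _]%SET
  (fun k i => nth tvec0 Us k i).
rewrite !cardsT card_ord => /(_ lt_size)[c [[j cj] _ c0]].
have := tdot_comb_ortho c j (orthofam_nth oU erefl).
rewrite /tdot big1 => [/esym/eqP|i _]; first by rewrite (negPf cj).
by rewrite /tcomb c0 ?inE // mul0r.
Qed.

(* A nonzero vector spanned by the eigenvectors of [H] above [a + e] and orthogonal
   to those of [K] above [a] would contradict the comparison of the quadratic forms. *)
Lemma count_gt_le H K lam mu Us Vs (a e : R) :
  herm_decomp H lam Us -> herm_decomp K mu Vs -> 0 <= a ->
  (forall x, complex.Re (qform H x) <= complex.Re (qform K x) + e * sqn x) ->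
  (count (fun l => a + e < l)%R lam <= count (fun l => a < l)%R mu)%N.
Proof.
move=> dH dK a0 HK; rewrite leqNgt; apply/negP.
rewrite -!(card_set_nth 0).
set P := [set k : 'I_(size lam) | _]%SET; set Q := [set k : 'I_(size mu) | _]%SET.
pose u (k : 'I_(size lam)) := nth tvec0 Us k.
pose v (k : 'I_(size mu)) := nth tvec0 Vs k.
have ou : orthofam u by case: dH => sU [oU _]; apply: orthofam_nth.
have ov : orthofam v by case: dK => sV [oV _]; apply: orthofam_nth.
move=> /(@kernel_vector _ _ _ P Q (fun k l => tdot (u k) (v l)))[c [[j cj] cP cQ]].
have := HK (tcomb c u); rewrite (qform_decomp _ dH) (qform_decomp _ dK) /=.
apply/negP; rewrite -ltNge.
have jP : j \in P by apply: contraNT cj => /cP ->.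
have lower : (a + e) * sqn (tcomb c u)
    < \sum_(k < size lam) nth 0 lam k * csq (tdot (tcomb c u) (u k)).
  rewrite (sqn_comb _ ou) mulr_sumr (bigD1 j) //= [X in _ < X](bigD1 j) //=.
  apply: ltr_leD.
    rewrite tdot_comb_ortho // ltr_pM2r ?csq_gt0 //.
    by move: jP; rewrite inE.
  apply: ler_sum => k _; rewrite tdot_comb_ortho //.
  have [|/cP ->] := boolP (k \in P); last by rewrite /csq /= expr0n addr0 !mulr0.
  by rewrite inE => /ltW le_k; rewrite ler_wpM2r ?csq_ge0.
apply: le_lt_trans lower; rewrite mulrDl lerD2r.
(* Bessel is only an inequality, as the eigenvectors of [K] need not span the space; the sign of [a]
   makes it usable. *)
apply: le_trans (ler_wpM2l a0 (bessel (tcomb c u) ov)).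
rewrite mulr_sumr; apply: ler_sum => l _.
have [lQ|] := boolP (l \in Q).
  by rewrite tdot_comb cQ // /csq /= expr0n addr0 !mulr0.
by rewrite inE -leNgt => le_l; rewrite ler_wpM2r ?csq_ge0.
Qed.

Lemma herm_decompN H lam Us : herm_decomp H lam Us ->
  herm_decomp (fun i j => - H i j) (map -%R lam) Us.
Proof.
case=> sU [oU HE]; split; first by rewrite size_map.
split=> // i j; rewrite HE size_map -sumrN; apply: eq_bigr => k _.
by rewrite (nth_map 0) // rmorphN mulNr.
Qed.

Lemma count_gt_uniq H lam mu Us Vs (a : R) :
  herm_decomp H lam Us -> herm_decomp H mu Vs -> 0 <= a ->
  count (fun l => a < l)%R lam = count (fun l => a < l)%R mu.
Proof.
move=> dlam dmu a0; apply/eqP; rewrite eqn_leq.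
by apply/andP; split; [have := @count_gt_le H H lam mu Us Vs a 0|
   have := @count_gt_le H H mu lam Vs Us a 0]; rewrite addr0; apply=> // x;
   rewrite mul0r addr0.
Qed.

Lemma count_lt_uniq H lam mu Us Vs (a : R) :
  herm_decomp H lam Us -> herm_decomp H mu Vs -> a <= 0 ->
  count (fun l => l < a)%R lam = count (fun l => l < a)%R mu.
Proof.
move=> /herm_decompN dlam /herm_decompN dmu a0.
have := @count_gt_uniq _ _ _ _ _ (- a) dlam dmu; rewrite oppr_ge0 => /(_ a0).
by rewrite !count_map; under eq_count do rewrite /= ltrN2;
  under [RHS]eq_count do rewrite /= ltrN2.
Qed.

Lemma count_neq0 (s : seq R) :
  count (fun l => l != 0)%R s = (count (fun l => 0 < l)%R s + count (fun l => l < 0)%R s)%N.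
Proof.
rewrite -count_predUI [X in (_ + X)%N](eq_count (a2 := pred0)) ?count_pred0 ?addn0.
  by apply: eq_count => l /=; rewrite neq_lt orbC.
by move=> l /=; case: ltgtP.
Qed.

Lemma count_neq0_uniq H lam mu Us Vs :
  herm_decomp H lam Us -> herm_decomp H mu Vs ->
  count (fun l => l != 0)%R lam = count (fun l => l != 0)%R mu.
Proof.
move=> dlam dmu; rewrite !count_neq0.
by rewrite (count_gt_uniq dlam dmu) // (count_lt_uniq dlam dmu).
Qed.

(** An upward closed predicate holds on an initial segment of a decreasing list. This translates
    between the eigenvalue of index [k] and counts. *)
Lemma nth_count (p : pred R) (s : seq R) k :
  sorted (fun a b : R => b <= a) s -> (forall a b, a <= b -> p a -> p b) ->
  (k < size s)%N -> p (nth 0 s k) = (k < count p s)%N.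
Proof.
move=> + pup; elim: s k => [//|z s IHs] k /= zs ks.
have s_le : all (fun t : R => t <= z) s.
  by apply: order_path_min zs => a b c ba cb; apply: le_trans cb ba.
have [pz|npz] := boolP (p z).
  by case: k ks => [|k] /= ks; rewrite ?pz // add1n ltnS IHs // (path_sorted zs).
have np (y : R) : y \in s -> ~~ p y.
  by move=> /(allP s_le) yz; apply: contraNN npz; apply: pup.
have -> : count p s = 0%N.
  by apply/eqP; rewrite -leqn0 leqNgt -has_count -all_predC; apply/allP => y /np.
case: k ks => [|k] /= ks; first by rewrite (negPf npz).
by apply/negbTE/np/mem_nth.
Qed.

(** The counts above nonnegative thresholds and below nonpositive ones are the same for all
    decompositions, and they determine a sorted list without zeros. *)
Lemma eigenvalues_uniq H lam mu Us Vs :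
  herm_decomp H lam Us -> herm_decomp H mu Vs ->
  sorted (fun a b : R => b <= a) lam -> sorted (fun a b : R => b <= a) mu ->
  all (fun l => l != 0)%R lam -> all (fun l => l != 0)%R mu -> lam = mu.
Proof.
move=> dlam dmu slam smu nlam nmu.
have size_eq : size lam = size mu.
  have := count_neq0_uniq dlam dmu.
  by rewrite (eqP (etrans (esym (all_count _ _)) nlam)) (eqP (etrans (esym (all_count _ _)) nmu)).
have le (la nu : seq R) Us' Vs' k : herm_decomp H la Us' -> herm_decomp H nu Vs' ->
    sorted (fun a b : R => b <= a) la -> sorted (fun a b : R => b <= a) nu ->
    all (fun l => l != 0)%R nu -> size la = size nu ->
    (k < size la)%N -> nth 0 nu k <= nth 0 la k.
  move=> dla dnu sla snu nnu sz ks; rewrite leNgt; apply/negP => lt_k.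
  have nuk : nth 0 nu k != 0 by apply: (allP nnu); rewrite mem_nth -?sz.
  have up (b x y : R) : x <= y -> b < x -> b < y by move=> xy bx; apply: lt_le_trans xy.
  have up' (b x y : R) : x <= y -> b <= x -> b <= y by move=> xy bx; apply: le_trans xy.
  (* In the positive case the threshold is cut off at 0 so that [count_gt_uniq] applies. In the
     negative case the entries at least [nth 0 nu k] are counted through their complement, to which
     [count_lt_uniq] applies. *)
  have [nu_gt0|nu_le0] := ltP 0 (nth 0 nu k).
    have := nth_count snu (up (Num.max (nth 0 la k) 0)) (eq_ind _ (fun n => k < n)%N ks _ sz).
    rewrite (count_gt_uniq dnu dla); last by rewrite le_max lexx orbT.
    rewrite -(nth_count sla (up _) ks) gt_max lt_k nu_gt0 /=.
    by rewrite gt_max ltxx.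
  have nu_lt0 : nth 0 nu k < 0 by rewrite lt_neqAle nuk.
  have := nth_count snu (up' (nth 0 nu k)) (eq_ind _ (fun n => k < n)%N ks _ sz).
  have cnt s : count (fun l => nth 0 nu k <= l)%R s
      = (size s - count (fun l => (l < nth 0 nu k)%R) s)%N.
    rewrite -(count_predC (fun l => (l < nth 0 nu k)%R)) addKn.
    by apply: eq_count => l /=; rewrite leNgt.
  rewrite lexx cnt (count_lt_uniq dnu dla) // -sz -cnt -(nth_count sla (up' _) ks).
  by rewrite leNgt lt_k.
apply: (@eq_from_nth _ 0) => // k ks; apply/eqP; rewrite eq_le.
by rewrite (le _ _ _ _ _ dmu dlam) ?(le _ _ _ _ _ dlam dmu) // -size_eq.
Qed.

(** This covers dropping zero eigenvalues, sorting and reversing: each selects distinct indices and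
    omits only vanishing terms. *)
Lemma herm_decomp_reindex H lam Us (js : seq nat) :
  herm_decomp H lam Us -> uniq js -> all (fun j => j < size lam)%N js ->
  (forall k, (k < size lam)%N -> k \notin js -> nth 0 lam k = 0) ->
  herm_decomp H [seq nth 0 lam j | j <- js] [seq nth tvec0 Us j | j <- js].
Proof.
case=> sU [oU HE] ujs jlt j0; split; first by rewrite !size_map.
split=> [a b|i j].
  rewrite size_map => a_lt b_lt; rewrite !(nth_map 0%N) // oU ?sU.
  - by rewrite nth_uniq.
  - by rewrite (allP jlt) // mem_nth.
  - by rewrite (allP jlt) // mem_nth.
pose F k : R[i] := (nth 0 lam k)%:C * (nth tvec0 Us k i * (nth tvec0 Us k j)^*).
rewrite HE size_map; transitivity (\sum_(k <- js) F k); last first.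
  rewrite (big_nth 0%N) big_mkord; apply: eq_bigr => k _.
  by rewrite !(nth_map 0%N).
rewrite -(big_mkord xpredT F) /index_iota subn0 (bigID (mem js)) /=.
rewrite [X in _ + X]big_seq_cond [X in _ + X]big1 ?addr0; last first.
  by move=> k; rewrite mem_iota /= add0n => /andP[k_lt kjs]; rewrite /F j0 // mul0r.
rewrite -big_filter; apply: perm_big; apply: uniq_perm => //.
  by rewrite filter_uniq // iota_uniq.
move=> k; rewrite mem_filter mem_iota /= add0n andb_idr //.
by move=> /(allP jlt).
Qed.

(** All decompositions have the same number of nonzero eigenvalues, so one without zeros is minimal,
    and the minimal one chosen by [hspec] has no zeros. Thus [hlam] can be read off from any sorted
    zero-free decomposition. *)
Lemma hlamP H lam Us : herm_decomp H lam Us ->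
  sorted (fun a b : R => b <= a) lam -> all (fun l => l != 0)%R lam ->
  hspec_ok H (hspec H) /\ hlam H = lam.
Proof.
move=> dlam slam nlam.
have min mu Vs : herm_decomp H mu Vs -> (size lam <= size mu)%N.
  move=> dmu; rewrite -(eqP (etrans (esym (all_count _ _)) nlam)).
  by rewrite (count_neq0_uniq dlam dmu) count_size.
have ex : exists p, hspec_ok H p.
  exists (lam, Us); split=> //; split=> //=; split=> //.
  by exists lam, Us.
have ok : hspec_ok H (hspec H).
  rewrite /hspec; case: pselect => [e|/(_ ex)//].
  exact: (proj2_sig (cid e)).
split=> //; case: (ok) => d [[_ minr] s].
apply: (eigenvalues_uniq d dlam s slam) => //.
rewrite all_count (count_neq0_uniq d dlam) eqn_leq.
by rewrite (eqP (etrans (esym (all_count _ _)) nlam)) (min _ _ d) (minr _ _ dlam).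
Qed.

Lemma herm_decomp_normal H lam Us : herm_decomp H lam Us ->
  exists mu Vs, [/\ herm_decomp H mu Vs, sorted (fun a b : R => b <= a) mu &
    all (fun l => l != 0)%R mu].
Proof.
move=> dlam.
pose leT (j k : nat) := nth 0 lam k <= nth 0 lam j.
pose js := sort leT [seq k <- iota 0 (size lam) | nth 0 lam k != 0].
exists [seq nth 0 lam j | j <- js], [seq nth tvec0 Us j | j <- js]; split.
- apply: herm_decomp_reindex => //.
  + by rewrite sort_uniq filter_uniq // iota_uniq.
  + by rewrite all_sort; apply/allP => k; rewrite mem_filter mem_iota => /andP[].
  + move=> k k_lt; rewrite mem_sort mem_filter mem_iota /= add0n k_lt andbT negbK.
    by move/eqP.
- by rewrite sorted_map; apply: sort_sorted => j k; apply: le_total.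
- by rewrite all_map all_sort; apply/allP => k; rewrite mem_filter => /andP[].
Qed.

Lemma hspec_okP H r : hrank H r -> hspec_ok H (hspec H) /\ size (hlam H) = r.
Proof.
move=> [[lam [Us [dlam sz]]] minr].
have [mu [Vs [dmu smu nmu]]] := herm_decomp_normal dlam.
have [ok hE] := hlamP dmu smu nmu.
split=> //; case: ok => d [[_ minh] _]; apply/eqP; rewrite eqn_leq -{1}sz.
by rewrite (minh _ _ dlam) (minr _ _ d).
Qed.

(** This decomposition need not be minimal, since [f] may vanish at an eigenvalue. *)
Lemma herm_decomp_fun (f : R -> R) H : hspec_ok H (hspec H) ->
  herm_decomp (tfun f H) (map f (hlam H)) (hspec H).2.
Proof.
case=> [[sU [oU _]] _]; split; first by rewrite size_map.
split=> // i j; rewrite /tfun size_map; apply: eq_bigr => k _.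
by rewrite (nth_map 0).
Qed.

(** Orthonormality removes the mixed terms, and the eigenvalues are real, so their squared moduli
    are squares. *)
Lemma herm_decomp_gram (A : tensor R I) lam Us : herm_decomp A lam Us ->
  herm_decomp (einstein (ctr A) A) [seq l ^+ 2 | l <- lam] Us.
Proof.
case=> sU [oU AE]; split; first by rewrite size_map.
split=> // i j; rewrite size_map /einstein /ctr.
pose u (k : 'I_(size lam)) := nth tvec0 Us k.
pose l (k : 'I_(size lam)) : R[i] := (nth 0 lam k)%:C.
transitivity (\sum_(k < size lam) \sum_(m < size lam)
    (l k * l m * (u k i * (u m j)^*)) * tdot (u m) (u k)).
  under eq_bigr => h _.
    rewrite !AE (rmorph_sum (@conjc R)) big_distrlr /=.
    over.
  rewrite exchange_big /=; apply: eq_bigr => k _.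
  rewrite exchange_big /=; apply: eq_bigr => m _.
  rewrite /tdot mulr_sumr; apply: eq_bigr => h _.
  by rewrite /l /u !conjE !conjcM conjcK conjc_real; ring.
apply: eq_bigr => k _; rewrite (bigD1 k) //= big1 ?addr0.
  by rewrite oU ?sU // eqxx mulr1 (nth_map 0) // rmorphXn /= expr2.
by move=> m mk; rewrite oU ?sU // -val_eqE /= in mk *; rewrite (negPf mk) mulr0.
Qed.

(** The zeros of such a list come last, where the default value of [nth] stands in for them. *)
Lemma nth_filter_neq0 (s : seq R) k : sorted (fun a b : R => b <= a) s ->
  all (fun l => 0 <= l) s -> nth 0 [seq l <- s | l != 0] k = nth 0 s k.
Proof.
elim: s k => [//|z s IHs] k /= zs /andP[z0 s0].
have [z_0|nz] /= := eqVneq z 0; last first.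
  by case: k => [//|k] /=; apply: IHs; rewrite ?(path_sorted zs).
have s00 (y : R) : y \in s -> y = 0.
  move=> ys; apply/eqP; rewrite eq_le (allP s0) // andbT.
  have /allP/(_ y ys) : all (fun t : R => t <= z) s.
    by apply: order_path_min zs => a b c ba cb; apply: le_trans cb ba.
  by rewrite z_0.
have -> : [seq l <- s | l != 0] = [::].
  apply/eqP; rewrite -[_ == _]negbK -has_filter.
  by apply/hasPn => y /s00 ->; rewrite eqxx.
rewrite z_0 nth_nil; case: k => [//|k] /=.
have [ks|sk] := ltnP k (size s); last by rewrite nth_default.
by rewrite (s00 _ (mem_nth 0 ks)).
Qed.

End Spectrum.

(** * Functional calculus and measurability of the eigenvalues *)

Section FunctionalCalculus.
Variables (R : realType) (N : nat) (I : 'I_N -> nat).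
Implicit Types (H K : tensor R I) (lam : seq R) (Us : seq (tvec R I)).

Lemma herm_decomp_filter H lam Us : herm_decomp H lam Us ->
  exists Vs, herm_decomp H [seq l <- lam | l != 0] Vs.
Proof.
move=> dlam; pose js := [seq j <- iota 0 (size lam) | nth 0 lam j != 0].
exists [seq nth tvec0 Us j | j <- js].
have -> : [seq l <- lam | l != 0] = [seq nth 0 lam j | j <- js].
  by rewrite -{1}[lam](mkseq_nth 0) /mkseq filter_map.
apply: herm_decomp_reindex => //.
- by rewrite filter_uniq // iota_uniq.
- by apply/allP => j; rewrite mem_filter mem_iota => /andP[].
- move=> k k_lt; rewrite mem_filter mem_iota /= add0n k_lt andbT negbK.
  by move/eqP.
Qed.

Lemma sorted_map_nondecr (f : R -> R) (s : seq R) : nondecr_fun f ->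
  sorted (fun a b => b <= a) s -> sorted (fun a b => b <= a) (map f s).
Proof. by move=> ndf; apply: homo_sorted => a b; apply: ndf. Qed.

(** The Gram tensor of [f(H)] has the squares of the [f l_i] as eigenvalues, and the square root
    restores them because [f] is nonnegative. Vanishing values drop out of [hlam]; the default 0
    replaces them. *)
Lemma nth_hlam_tabs_tfun (f : R -> R) H r k :
  nondecr_fun f -> (forall x, 0 <= f x) -> hrank H r ->
  nth 0 (hlam (tabs (tfun f H))) k = nth 0 (map f (hlam H)) k.
Proof.
move=> ndf f0 rkH; have [ok _] := hspec_okP rkH.
have sH : sorted (fun a b => b <= a) (hlam H) by case: ok => _ [].
pose s := map f (hlam H).
have ss : sorted (fun a b => b <= a) s by apply: sorted_map_nondecr.
have s0 : all (fun l => 0 <= l) s.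
  by rewrite all_map; apply/allP => x _; apply: f0.
set B := einstein (ctr (tfun f H)) (tfun f H).
have dB : herm_decomp B [seq l ^+ 2 | l <- s] (hspec H).2.
  exact: herm_decomp_gram (herm_decomp_fun f ok).
have [Vs dB'] := herm_decomp_filter dB.
set nu := [seq l <- _ | _] in dB'.
have le_trans' : transitive (fun a b : R => b <= a).
  by move=> a b c ab ca; apply: le_trans ca ab.
have nuE : nu = [seq l ^+ 2 | l <- [seq l <- s | l != 0]].
  rewrite /nu filter_map; congr map; apply: eq_filter => l /=.
  by rewrite sqrf_eq0.
have snu : sorted (fun a b => b <= a) nu.
  apply: sorted_filter => //; rewrite -map_comp.
  apply: (@sorted_map_nondecr (fun x => f x ^+ 2)) => // x y xy.
  by rewrite lerXn2r ?nnegrE // ndf.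
have [okB hB] := hlamP dB' snu (filter_all _ _).
have dA := herm_decomp_fun Num.sqrt okB.
have sqrtE : map Num.sqrt (hlam B) = [seq l <- s | l != 0].
  rewrite hB nuE -map_comp -[RHS]map_id; apply/eq_in_map => l /=.
  by rewrite mem_filter => /andP[_ ls]; rewrite sqrtr_sqr ger0_norm // (allP s0).
rewrite sqrtE in dA.
have [_ hA] := hlamP dA (sorted_filter le_trans' _ ss) (filter_all _ _).
by rewrite /tabs hA nth_filter_neq0.
Qed.

Lemma tapply_decomp H lam Us x : herm_decomp H lam Us ->
  tapply H x = tcomb (fun k : 'I_(size lam) =>
    real_complex R (nth 0 lam k) * tdot x (nth tvec0 Us k)) (fun k => nth tvec0 Us k).
Proof.
case=> _ [_ HE]; apply/funext => i; rewrite /tapply /tcomb.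
under eq_bigr do rewrite HE mulr_suml.
rewrite exchange_big; apply: eq_bigr => k _ /=.
rewrite /tdot mulr_sumr mulr_suml; apply: eq_bigr => j _; ring.
Qed.

Lemma csqM_real (a : R) (z : R[i]) : csq (real_complex R a * z) = a ^+ 2 * csq z.
Proof. by case: z => b c; rewrite /csq /=; ring. Qed.

Lemma sqn_tapply H lam Us x : herm_decomp H lam Us -> sqn (tapply H x)
  = \sum_(k < size lam) nth 0 lam k ^+ 2 * csq (tdot x (nth tvec0 Us k)).
Proof.
move=> dH; rewrite (tapply_decomp _ dH) sqn_comb; last first.
  by case: dH => sU [oU _]; apply: orthofam_nth.
by apply: eq_bigr => k _; rewrite csqM_real.
Qed.

Lemma vnormE (x : tvec R I) : vnorm x = Num.sqrt (sqn x).
Proof. by []. Qed.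

Lemma hlam_le_opnorm H r k : hrank H r -> (k < r)%N ->
  `|nth 0 (hlam H) k| <= opnorm H.
Proof.
move=> rkH kr; have [[dH _] sz] := hspec_okP rkH.
rewrite -/(hlam H) in dH; set Us := (hspec H).2 in dH; set lam := hlam H in dH sz *.
have k_lt : (k < size lam)%N by rewrite sz.
have [sU [oU _]] := dH.
pose u (j : 'I_(size lam)) := nth tvec0 Us j; pose k0 := Ordinal k_lt.
have ou : orthofam u by apply: orthofam_nth.
have sqnu : sqn (u k0) = 1.
  by apply: (@complexI R); rewrite -tdotxx ou eqxx.
apply: sup_upper_bound.
  split; first by exists (vnorm (tapply H (u k0))), (u k0); rewrite //= vnormE sqnu sqrtr1.
  (* This crude bound only shows that the supremum defining the operator norm is finite; the
     estimate itself comes from the unit eigenvector [u k0]. *)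
  exists (Num.sqrt (\sum_(j < size lam) nth 0 lam j ^+ 2)) => _ [x x1 <-].
  have sqnx : sqn x = 1.
    have := congr1 (fun a => a ^+ 2) x1.
    by rewrite vnormE sqr_sqrtr ?sqn_ge0 // expr1n.
  rewrite vnormE (sqn_tapply _ dH) ler_sqrt; last first.
    by apply: sumr_ge0 => j _; apply: sqr_ge0.
  apply: ler_sum => j _; rewrite -[leRHS]mulr1 ler_wpM2l ?sqr_ge0 //.
  rewrite -sqnx; apply: le_trans (bessel x ou).
  by rewrite (bigD1 j) //= lerDl sumr_ge0 // => l _; apply: csq_ge0.
exists (u k0); first by rewrite /= vnormE sqnu sqrtr1.
rewrite vnormE (sqn_tapply _ dH) (bigD1 k0) //= big1 ?addr0.
  rewrite (ou k0 k0) eqxx /csq /= expr1n expr0n addr0 mulr1 sqrtr_sqr //.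
move=> j jk; rewrite (ou k0 j) eq_sym (negPf jk).
by rewrite /csq /= expr0n addr0 mulr0.
Qed.

(* Bounds the difference of the quadratic forms of [H] and [K] on unit vectors. *)
Definition tdist H K : R := \sum_i \sum_j 2 *
  (`|complex.Re (H i j) - complex.Re (K i j)|
   + `|complex.Im (H i j) - complex.Im (K i j)|).

Lemma Re_sum (J : finType) (F : J -> R[i]) :
  complex.Re (\sum_j F j) = \sum_j complex.Re (F j).
Proof. by elim/big_rec2: _ => // j y z _ <-; case: z (F j) => a b []. Qed.

(** With [h - h' = P + i Q], the real parts differ by [P (a c + b d) - Q (a d - b c)]; both brackets
    are at most [s] in modulus because [2 |x y| <= x^2 + y^2]. *)
Lemma Re_sesqui_le (z w h h' : R[i]) (s : R) : csq z <= s -> csq w <= s ->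
  complex.Re (conjc z * h * w) <= complex.Re (conjc z * h' * w)
    + 2 * (`|complex.Re h - complex.Re h'| + `|complex.Im h - complex.Im h'|) * s.
Proof.
case: z w h h' => [a b] [c d] [p q] [p' q']; rewrite /csq /= => zs ws.
set P := p - p'; set Q := q - q'.
have -> : p = P + p' by rewrite /P; ring.
have -> : q = Q + q' by rewrite /Q; ring.
have m1 : `|a * c + b * d| <= s.
  rewrite ler_norml; have := sqr_ge0 (a - c); have := sqr_ge0 (b - d).
  have := sqr_ge0 (a + c); have := sqr_ge0 (b + d).
  by rewrite !expr2 in zs ws *; move=> *; apply/andP; split; lra.
have m2 : `|a * d - b * c| <= s.
  rewrite ler_norml; have := sqr_ge0 (a - d); have := sqr_ge0 (b - c).
  have := sqr_ge0 (a + d); have := sqr_ge0 (b + c).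
  by rewrite !expr2 in zs ws *; move=> *; apply/andP; split; lra.
have n1 : P * (a * c + b * d) <= `|P| * s.
  by apply: le_trans (ler_norm _) _; rewrite normrM ler_wpM2l.
have n2 : - (Q * (a * d - b * c)) <= `|Q| * s.
  by apply: le_trans (ler_norm _) _; rewrite normrN normrM ler_wpM2l.
have s0 : 0 <= s by apply: le_trans zs; rewrite addr_ge0 ?sqr_ge0.
have := mulr_ge0 (normr_ge0 P) s0; have := mulr_ge0 (normr_ge0 Q) s0; lra.
Qed.

Lemma qform_le_tdist H K x :
  complex.Re (qform H x) <= complex.Re (qform K x) + tdist H K * sqn x.
Proof.
rewrite /qform /tdist mulr_suml !Re_sum -big_split; apply: ler_sum => i _ /=.
rewrite mulr_suml !Re_sum -big_split; apply: ler_sum => j _ /=.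
have le_sqn k : csq (x k) <= sqn x.
  by rewrite /sqn (bigD1 k) //= lerDl sumr_ge0 // => l _; apply: csq_ge0.
exact: Re_sesqui_le.
Qed.

End FunctionalCalculus.

(** * Lower semicontinuity and measurability of the eigenvalues *)

Section Measurability.
Variables (R : realType) (N : nat) (I : 'I_N -> nat) (T : pmetricType R).
Implicit Types D : T -> tensor R I.

Lemma tdist_continuous D t0 : tcontinuous D ->
  tdist (D t0) (D t) @[t --> t0] --> tdist (D t0) (D t0).
Proof.
move=> cD; rewrite /tdist; apply: cvg_big => [|i _]; first exact: add_continuous.
apply: cvg_big => [|j _]; first exact: add_continuous.
have [cRe cIm] := cD i j.
apply: cvgM; first exact: cvg_cst.
apply: cvgD; apply: cvg_norm; (apply: cvgB; first exact: cvg_cst).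
  exact: cRe.
exact: cIm.
Qed.

Lemma tdistxx (H : tensor R I) : tdist H H = 0.
Proof.
by apply: big1 => i _; apply: big1 => j _; rewrite !subrr normr0 addr0 mulr0.
Qed.

(** With [e] half the gap between [a] and the eigenvalue of index [k] at [t0], [count_gt_le] applies
    at every [t] where [tdist (D t0) (D t) < e]: at least as many eigenvalues of [D t] exceed [a] as
    eigenvalues of [D t0] exceed [a + e]. *)
Lemma open_count_gt D (a : R) k : tcontinuous D ->
  (forall t, hspec_ok (D t) (hspec (D t))) -> 0 <= a ->
  open [set t | (k < count (fun l => a < l)%R (hlam (D t)))%N].
Proof.
move=> cD okD a0; rewrite openE => t0 /= kt0.
have [d0 [_ s0]] := okD t0.
rewrite -/(hlam (D t0)) in d0 s0.
have k_lt : (k < size (hlam (D t0)))%N by apply: leq_trans kt0 (count_size _ _).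
have up (b x y : R) : x <= y -> b < x -> b < y by move=> xy bx; apply: lt_le_trans xy.
have lt_a : a < nth 0 (hlam (D t0)) k by rewrite (nth_count s0 (up a)).
pose e := (nth 0 (hlam (D t0)) k - a) / 2.
have e0 : 0 < e by rewrite divr_gt0 // subr_gt0.
have kt0' : (k < count (fun l => a + e < l)%R (hlam (D t0)))%N.
  by rewrite -(nth_count s0 (up (a + e))) // /e; lra.
have := cvgr_lt _ (tdist_continuous (t0 := t0) cD) e.
rewrite tdistxx => /(_ _ e0); apply: filterS => t lt_e /=.
apply: leq_trans kt0' _; have [dt _] := okD t.
apply: (count_gt_le d0 dt a0) => x; apply: le_trans (qform_le_tdist _ (D t) x) _.
by rewrite lerD2l ler_wpM2r ?sqn_ge0 // ltW.
Qed.

Lemma measurable_hlam_pos D k r : tcontinuous D ->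
  (forall t, hspec_ok (D t) (hspec (D t))) -> (forall t, size (hlam (D t)) = r) ->
  (k < r)%N ->
  measurable_fun (setT : set (g_sigma_algebraType (@open T)))
    (fun t => Num.max (nth 0 (hlam (D t)) k) 0).
Proof.
move=> cD okD szD kr; apply: (measurability _ (RGenOInfty.measurableE R)).
move=> /= _ [_ [a ->] <-]; rewrite setTI preimage_itvoy.
apply: sub_sigma_algebra; have [a0|a0] := leP 0 a; last first.
  rewrite (_ : [set _ | _] = setT); first exact: openT.
  by apply/seteqP; split => // t _ /=; rewrite lt_max a0 orbT.
rewrite (_ : [set _ | _] = [set t | (k < count (fun l => a < l)%R (hlam (D t)))%N]).
  exact: open_count_gt.
apply/seteqP; split => t /=; rewrite lt_max (ltNge a 0) a0 orbF;
  rewrite (@nth_count _ (fun l => a < l)) ?szD //;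
  do ?[by case: (okD t) => _ [] | by move=> x y xy ax; apply: lt_le_trans xy].
Qed.

Lemma hlamN (H : tensor R I) : hspec_ok H (hspec H) ->
  let H' : tensor R I := fun i j => - H i j in
  hspec_ok H' (hspec H') /\ hlam H' = rev (map -%R (hlam H)).
Proof.
move=> [dH [rkH sH]] /=; rewrite -/(hlam H) in dH sH rkH.
set s := map -%R (hlam H).
have sE : rev s = [seq nth 0 s j | j <- rev (iota 0 (size s))].
  by rewrite map_rev -/(mkseq _ _) mkseq_nth.
(* Filtering out a zero would give a decomposition shorter than the rank. *)
have nH : all (fun l => l != 0) (hlam H).
  have [Vs dV] := herm_decomp_filter dH.
  rewrite all_count -size_filter eqn_leq size_filter count_size -size_filter.
  by case: rkH => _ /(_ _ _ dV).
have d : herm_decomp (fun i j => - H i j) (rev s)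
    [seq nth tvec0 (hspec H).2 j | j <- rev (iota 0 (size s))].
  rewrite sE; apply: herm_decomp_reindex; first exact: herm_decompN.
  - by rewrite rev_uniq iota_uniq.
  - by apply/allP => j; rewrite mem_rev mem_iota.
  - by move=> j jlt; rewrite mem_rev mem_iota /= add0n jlt.
apply: (hlamP d).
- rewrite rev_sorted; apply: homo_sorted sH => x y /=.
  by rewrite lerN2.
- by rewrite all_rev all_map; apply/allP => l /(allP nH) /=; rewrite oppr_eq0.
Qed.

Lemma measurable_hlam D k r : tcontinuous D -> (forall t, hrank (D t) r) ->
  measurable_fun (setT : set (g_sigma_algebraType (@open T)))
    (fun t => nth 0 (hlam (D t)) k).
Proof.
move=> cD rkD.
have okD t := (hspec_okP (rkD t)).1; have szD t := (hspec_okP (rkD t)).2.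
have [kr|rk] := ltnP k r; last first.
  rewrite (_ : (fun _ => _) = fun=> 0); first exact: measurable_cst.
  by apply/funext => t; rewrite nth_default ?szD.
pose D' t : tensor R I := fun i j => - D t i j.
have cD' : tcontinuous D'.
  move=> i j; have [cRe cIm] := cD i j; split=> t.
    rewrite (_ : (fun t => _) = (fun t => - complex.Re (D t i j))).
      by apply: cvgN; apply: cRe.
    by apply/funext => u; rewrite /D'; case: (D u i j).
  rewrite (_ : (fun t => _) = (fun t => - complex.Im (D t i j))).
    by apply: cvgN; apply: cIm.
  by apply/funext => u; rewrite /D'; case: (D u i j).
(* Negation reverses the order, and the constant rank makes the new index independent of [t]. *)
have nthD' t : nth 0 (hlam (D' t)) (r - k.+1) = - nth 0 (hlam (D t)) k.
  rewrite (hlamN (okD t)).2 nth_rev size_map szD; last by rewrite ltn_subrL (leq_trans _ kr).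
  by rewrite subnSK // subKn ?(ltnW kr) // (nth_map 0) ?szD.
have mpos := measurable_hlam_pos cD okD szD kr.
have mneg := @measurable_hlam_pos D' (r - k.+1) r cD' (fun t => (hlamN (okD t)).1).
have {}mneg : measurable_fun (setT : set (g_sigma_algebraType (@open T)))
    (fun t => Num.max (nth 0 (hlam (D' t)) (r - k.+1)) 0).
  apply: mneg => [t|]; last by rewrite ltn_subrL (leq_trans _ kr).
  by rewrite (hlamN (okD t)).2 size_rev size_map szD.
rewrite (_ : (fun _ => _) = (fun t => Num.max (nth 0 (hlam (D t)) k) 0)
   \- (fun t => Num.max (nth 0 (hlam (D' t)) (r - k.+1)) 0)); last first.
  apply/funext => t /=; rewrite nthD'.
  by case: (leP (nth 0 (hlam (D t)) k) 0) => h;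
     case: (leP (- nth 0 (hlam (D t)) k) 0) => h'; lra.
exact: measurable_funB.
Qed.

End Measurability.

(** * The equivalence *)

Section Integration.
Context d (T : measurableType d) (R : realType).

(* The larger function need not be measurable: the integral of a nonnegative
   function is a supremum over the simple functions below it. *)
Lemma le_integral_ge0 (mu : {measure set T -> \bar R}) (g G : T -> \bar R) :
  (forall x, 0 <= G x)%E -> (forall x, g x <= G x)%E ->
  (\int[mu]_x g x <= \int[mu]_x G x)%E.
Proof.
move=> G0 gG; rewrite integralE.
apply: (@le_trans _ _ (\int[mu]_x (g^\+ x)%E)%E).
  by rewrite -[leRHS]sube0 leeB // integral_ge0.
rewrite !ge0_integralTE //; apply: le_ereal_sup => _ [h /= hg <-].
exists h => // x; apply: le_trans (hg x) _.
by rewrite funeposE ge_max gG G0.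
Qed.

(** Total mass one preserves the constant [K], and integrability makes [fine] lossless. *)
Lemma integral_affine (mu : probability T R) n (w : 'I_n -> R)
    (h : 'I_n -> T -> R) (K : R) :
  (forall i, mu.-integrable setT (EFin \o h i)) ->
  (\int[mu]_t (\sum_i w i * h i t + K)%:E
   = (\sum_i w i * fine (\int[mu]_t (h i t)%:E) + K)%:E)%E.
Proof.
move=> ih.
have iw i : mu.-integrable setT (fun t => (w i)%:E * (h i t)%:E)%E.
  exact: (integrableZl measurableT _ (ih i)).
under eq_integral => t _.
  rewrite EFinD -sumEFin.
  under eq_bigr do rewrite EFinM.
  over.
rewrite integralD //=; first last.
- exact: finite_measure_integrable_cst.
- exact: integrable_sum.
have -> : (\int[mu]_t K%:E = K%:E)%E.
  transitivity (K%:E * mu setT)%E; first exact: integral_cst.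
  by rewrite probability_setT mule1.
rewrite integral_sum //.
rewrite EFinD -sumEFin; congr (_ + _)%E; apply: eq_bigr => i _.
rewrite (integralZl measurableT (ih i)) EFinM fineK //.
exact: (integrable_fin_num measurableT (ih i)).
Qed.

Lemma bounded_measurable_integrable (mu : probability T R) (h : T -> R) (b : R) :
  measurable_fun setT h -> (forall t, `|h t| <= b) ->
  mu.-integrable setT (EFin \o h).
Proof.
move=> mh hb; have := finite_measure_integrable_cst mu b measurableT.
apply: le_integrable => //; first exact/measurable_EFinP.
move=> t _ /=; rewrite lee_fin; apply: le_trans (hb t) _; exact: ler_norm.
Qed.

End Integration.

Lemma nth_all_ge0 (R : realType) (s : seq R) (i : nat) :
  all (fun l => 0 <= l) s -> 0 <= nth 0 s i.
Proof.
move=> s0; have [si|is_lt] := leqP (size s) i; first by rewrite nth_default.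
exact: (allP s0) (mem_nth 0 is_lt).
Qed.

(** Nonnegativity keeps the order valid past the end of the list, where [nth] returns 0. *)
Lemma nth_decreasing (R : realType) (s : seq R) (i j : nat) :
  sorted (fun a b => b <= a) s -> all (fun l => 0 <= l) s -> (i <= j)%N ->
  nth 0 s j <= nth 0 s i.
Proof.
move=> ss s0 ij.
have [js|sj] := ltnP j (size s).
  apply: (@sorted_leq_nth _ (fun a b : R => b <= a)) => //.
  - by move=> a b c ab ca; apply: le_trans ca ab.
  - by rewrite inE (leq_ltn_trans ij).
by rewrite (nth_default _ sj) nth_all_ge0.
Qed.

Lemma sum_nth_widen (R : realType) (n r : nat) (rn : (r <= n)%N)
    (phi : 'I_n -> R) (s : seq R) : size s = r ->
  \sum_(k < n) phi k * nth 0 s k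
  = \sum_(i < r) phi (widen_ord rn i) * nth 0 s i.
Proof.
move=> szs; rewrite (bigID (fun k : 'I_n => (k < r)%N)) /= [X in _ + X]big1 ?addr0.
  exact: big_ord_narrow.
by move=> k; rewrite -leqNgt => rk; rewrite nth_default ?mulr0 ?szs.
Qed.

Lemma subgradient_ge0 (R : realType) (f c : R -> R) : nondecr_fun f ->
  (forall x y, f x + c x * (y - x) <= f y) -> forall x, 0 <= c x.
Proof.
move=> ndf cP x; have := cP x (x - 1).
have : f (x - 1) <= f x by apply: ndf; lra.
lra.
Qed.

(** Adding the subgradient inequalities at the two points cancels the values of [f]. *)
Lemma subgradient_nondecr (R : realType) (f c : R -> R) :
  (forall x y, f x + c x * (y - x) <= f y) -> nondecr_fun c.
Proof.
move=> cP x y; rewrite le_eqVlt => /orP[/eqP -> //|xy].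
rewrite -(ler_pM2r (_ : 0 < y - x)) ?subr_gt0 //.
have := cP x y; have := cP y x; lra.
Qed.

(** * The two implications *)

Section Main.
Variables (R : realType) (N : nat) (I : 'I_N -> nat).

Lemma hrank_le_ndim (H : tensor R I) r : hrank H r -> (r <= ndim I)%N.
Proof.
by case=> [[lam [Us [[<- [oU _]] <-]]] _]; apply: orthonormal_size.
Qed.

Lemma sorted_hlam (H : tensor R I) r : hrank H r ->
  sorted (fun a b => b <= a) (hlam H).
Proof. by move=> /hspec_okP[[_ []]]. Qed.

Lemma uinorm_tfun (f : R -> R) (H : tensor R I) r rho :
  nondecr_fun f -> (forall x, 0 <= f x) -> hrank H r ->
  uinorm rho (tfun f H) = rho (fun k => nth 0 (map f (hlam H)) k).
Proof.
move=> ndf f0 rkH; rewrite /uinorm; congr rho; apply/funext => k.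
exact: nth_hlam_tabs_tfun rkH.
Qed.

Lemma kyfan_sym_gauge k : (0 < k)%N ->
  sym_gauge (N := N) (I := I) (@kyfan R (ndim I) k).
Proof.
move=> k0; split; first exact: kyfan_ge0.
split; first by move=> x; apply: kyfan_eq0.
split; first exact: kyfanZ.
split; first exact: kyfanD.
by split; [exact: kyfan_perm | exact: kyfan_sign].
Qed.

Variables (T : pmetricType R) (nu : probability (g_sigma_algebraType (@open T)) R).
Variables (A : tensor R I) (D : T -> tensor R I) (r : nat).

Definition mean_hlam (k : nat) : R := fine (\int[nu]_t (nth 0 (hlam (D t)) k)%:E).

Lemma hlam_bounded :
  (exists M : R, forall t, opnorm (D t) <= M) -> (forall t, hrank (D t) r) ->
  exists b : R, forall t k, `|nth 0 (hlam (D t)) k| <= b.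
Proof.
move=> [M DM] rkD; exists (Num.max M 0) => t k.
have [kr|rk] := ltnP k r.
  by apply: le_trans (hlam_le_opnorm (rkD t) kr) _; rewrite le_max DM.
rewrite nth_default ?normr0 ?le_max ?lexx ?orbT //.
by rewrite (hspec_okP (rkD t)).2.
Qed.

Lemma integrable_hlam k : tcontinuous D ->
  (exists M : R, forall t, opnorm (D t) <= M) -> (forall t, hrank (D t) r) ->
  nu.-integrable setT (EFin \o (fun t => nth 0 (hlam (D t)) k)).
Proof.
move=> cD bD rkD; have [b hb] := hlam_bounded bD rkD.
apply: (@bounded_measurable_integrable _ _ _ nu _ b) => [|t]; last exact: hb.
exact: measurable_hlam cD rkD.
Qed.

Lemma uinorm_le_of_wmaj (f : R -> R) rho : tcontinuous D ->
  (exists M : R, forall t, opnorm (D t) <= M) ->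
  hrank A r -> (forall t, hrank (D t) r) ->
  wmaj (hlam A) (mkseq mean_hlam r) ->
  nondecr_fun f -> convex_fun f -> (forall x, 0 <= f x) -> sym_gauge rho ->
  ((uinorm rho (tfun f A))%:E <= \int[nu]_t (uinorm rho (tfun f (D t)))%:E)%E.
Proof.
move=> cD bD rkA rkD [_ maj] ndf cf f0 [rho0 [_ [rhoZ [rhoD [rhoS rhoE]]]]].
rewrite (uinorm_tfun _ ndf f0 rkA).
under eq_integral do rewrite (uinorm_tfun _ ndf f0 (rkD _)).
have szA : size (hlam A) = r := (hspec_okP rkA).2.
have szD t : size (hlam (D t)) = r := (hspec_okP (rkD t)).2.
have rn := hrank_le_ndim rkA.
have sA := sorted_hlam rkA.
pose x i := nth 0 (hlam A) i.
have fA0 : all (fun l => 0 <= l) (map f (hlam A)).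
  by rewrite all_map; apply/allP => l _; apply: f0.
have sfA := sorted_map_nondecr ndf sA.
have [phi [phi0 phidec phiv phi_le]] := gauge_decreasing_support
  (v := fun k : 'I_(ndim I) => nth 0 (map f (hlam A)) k) rhoZ rhoD rhoS rhoE
  (fun k => nth_all_ge0 k fA0) (fun i j => nth_decreasing sfA fA0).
have [c cP] := convex_subgradient cf.
have c0 := subgradient_ge0 ndf cP.
have cmono := subgradient_nondecr cP.
pose phi' i := phi (widen_ord rn i).
pose w i := phi' i * c (x i).
have w0 i : 0 <= w i by apply: mulr_ge0; [exact: phi0 | exact: c0].
have wdec (i j : 'I_r) : (i <= j)%N -> w j <= w i.
  move=> ij; apply: ler_pM; [exact: phi0 | exact: c0 | exact: phidec |].
  apply: cmono; apply: (@sorted_leq_nth _ (fun a b : R => b <= a)) => //.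
  - by move=> a b e ab ea; apply: le_trans ea ab.
  - by rewrite inE szA.
  - by rewrite inE szA.
pose V := \sum_(i < r) phi' i * f (x i).
have rhoV : rho (fun k => nth 0 (map f (hlam A)) k) <= V.
  apply: le_trans phiv _; rewrite (sum_nth_widen rn) ?size_map //.
  by apply: ler_sum => i _; rewrite (nth_map 0) ?szA.
(* This constant makes the affine function of the spectrum below equal to [V] at [x]. *)
pose K := V - \sum_(i < r) w i * x i.
have lower t : \sum_(i < r) w i * nth 0 (hlam (D t)) i + K
    <= rho (fun k => nth 0 (map f (hlam (D t))) k).
  apply: le_trans (phi_le _); rewrite (sum_nth_widen rn) ?size_map //.
  rewrite /K /V addrCA -sumrB -big_split; apply: ler_sum => i _ /=.
  rewrite (nth_map 0) ?szD //.
  have := ler_wpM2l (phi0 (widen_ord rn i)) (cP (x i) (nth 0 (hlam (D t)) i)).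
  by rewrite /w /phi'; lra.
have abel : 0 <= \sum_(i < r) w i * (mean_hlam i - x i).
  apply: (abel_sum_ge0 (d := fun i => mean_hlam i - x i)) => // k kr.
  rewrite sumrB subr_ge0; have := maj k; rewrite szA => /(_ kr).
  congr (_ <= _); apply: eq_bigr => i _.
  by rewrite nth_mkseq // (leq_trans _ kr).
(* The affine minorant integrates to its value at the mean spectrum, which is at least [V] by
   [abel]. *)
apply: (@le_trans _ _ (\int[nu]_t (\sum_(i < r) w i * nth 0 (hlam (D t)) i + K)%:E)%E).
  rewrite (@integral_affine _ _ _ nu r w (fun i t => nth 0 (hlam (D t)) i)); last first.
    by move=> i; apply: integrable_hlam.
  rewrite lee_fin; apply: le_trans rhoV _.
  rewrite -subr_ge0; move: abel; congr (_ <= _).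
  under eq_bigr do rewrite mulrBr.
  by rewrite sumrB /K /mean_hlam; ring.
by apply: le_integral_ge0 => t; rewrite lee_fin.
Qed.

Lemma wmaj_of_uinorm_le : tcontinuous D ->
  (exists M : R, forall t, opnorm (D t) <= M) ->
  hrank A r -> (forall t, hrank (D t) r) ->
  (forall f : R -> R, nondecr_fun f -> convex_fun f -> (forall x, 0 <= f x) ->
   forall rho, sym_gauge rho ->
   ((uinorm rho (tfun f A))%:E <= \int[nu]_t (uinorm rho (tfun f (D t)))%:E)%E) ->
  wmaj (hlam A) (mkseq mean_hlam r).
Proof.
move=> cD bD rkA rkD H.
have szA : size (hlam A) = r := (hspec_okP rkA).2.
have szD t : size (hlam (D t)) = r := (hspec_okP (rkD t)).2.
have rn := hrank_le_ndim rkA.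
split=> [|k]; first by rewrite size_mkseq.
rewrite szA => kr.
have [->|k_gt0] := posnP k; first by rewrite !big_ord0.
have [b hb] := hlam_bounded bD rkD.
(* After this shift all eigenvalues of [A] and of every [D t] are nonnegative, so [f] acts on them
   as translation by [c]. *)
pose c := Num.max b (\sum_(i < r) `|nth 0 (hlam A) i|).
have cA (i : nat) : (i < r)%N -> 0 <= nth 0 (hlam A) i + c.
  move=> ir; rewrite -lerBlDr sub0r.
  have : `|nth 0 (hlam A) i| <= c.
    rewrite le_max; apply/orP; right.
    by rewrite (bigD1 (Ordinal ir)) //= lerDl sumr_ge0.
  by rewrite ler_norml => /andP[].
have cDt t i : 0 <= nth 0 (hlam (D t)) i + c.
  rewrite -lerBlDr sub0r.
  have : `|nth 0 (hlam (D t)) i| <= c by rewrite le_max hb.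
  by rewrite ler_norml => /andP[].
pose f x : R := Num.max (x + c) 0.
have ndf : nondecr_fun f.
  by move=> x y xy; rewrite /f ge_max !le_max lerD2r xy lexx orbT.
have f0 x : 0 <= f x by rewrite /f le_max lexx orbT.
have cf : convex_fun f.
  move=> x y t /andP[t0 t1]; rewrite {1}/f ge_max; apply/andP; split.
    have hx : x + c <= f x by rewrite /f le_max lexx.
    have hy : y + c <= f y by rewrite /f le_max lexx.
    have t1' : 0 <= 1 - t by rewrite subr_ge0.
    have := ler_wpM2l t0 hx; have := ler_wpM2l t1' hy; lra.
  by rewrite addr_ge0 // mulr_ge0 // subr_ge0.
(* As [k <= r], the first [k] entries are shifted eigenvalues and not padding. The shift contributes
   the same [k c] on both sides and cancels at the end. *)
have kyfanE (B : tensor R I) : hrank B r ->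
    (forall i, (i < k)%N -> 0 <= nth 0 (hlam B) i + c) ->
    kyfan k (fun j : 'I_(ndim I) => nth 0 (map f (hlam B)) j)
    = \sum_(i < k) nth 0 (hlam B) i + \sum_(i < k) c.
  move=> rkB cB; have szB : size (hlam B) = r := (hspec_okP rkB).2.
  have fB0 : all (fun l => 0 <= l) (map f (hlam B)).
    by rewrite all_map; apply/allP => l _; apply: f0.
  rewrite kyfan_decreasing; first last.
  - by move=> i j ij; apply: nth_decreasing => //; apply: sorted_map_nondecr (sorted_hlam rkB).
  - by move=> i; apply: nth_all_ge0.
  rewrite -(big_ord_widen _ (fun i => nth 0 (map f (hlam B)) i)); last exact: leq_trans rn.
  rewrite -big_split; apply: eq_bigr => i _ /=.
  rewrite (nth_map 0); last by rewrite szB (leq_trans _ kr).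
  by rewrite /f max_l // cB.
have := H f ndf cf f0 _ (kyfan_sym_gauge k_gt0).
rewrite (uinorm_tfun _ ndf f0 rkA).
under eq_integral do rewrite (uinorm_tfun _ ndf f0 (rkD _)) kyfanE //.
rewrite kyfanE //; last by move=> i ik; apply/cA/(leq_trans ik).
under eq_integral => t _.
  under eq_bigr do rewrite -[nth _ _ _]mul1r.
  over.
rewrite (@integral_affine _ _ _ nu k (fun=> 1) (fun i t => nth 0 (hlam (D t)) i)); last first.
  by move=> i; apply: integrable_hlam.
rewrite lee_fin lerD2r; congr (_ <= _); apply: eq_bigr => i _.
by rewrite mul1r nth_mkseq // (leq_trans _ kr).
Qed.

End Main.

Unset Implicit Arguments.

Theorem theorem3p1 (R : realType) (N : nat) (I : 'I_N -> nat)
  (Omega : pmetricType R)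
  (nu : probability (g_sigma_algebraType (@open Omega)) R)
  (Ct : tensor R I) (D : Omega -> tensor R I) (r : nat) :
  sigma_compact Omega ->
  herm_tensor Ct -> (forall t, herm_tensor (D t)) ->
  tcontinuous D ->
  (exists M : R, forall t, opnorm (D t) <= M) ->
  hrank Ct r -> (forall t, hrank (D t) r) ->
  wmaj (hlam Ct)
       (mkseq (fun k => fine (\int[nu]_t (nth 0 (hlam (D t)) k)%:E)) r)
  <->
  (forall f : R -> R, nondecr_fun f -> convex_fun f -> (forall x, 0 <= f x) ->
   forall rho, sym_gauge rho ->
   ((uinorm rho (tfun f Ct))%:E <= \int[nu]_t (uinorm rho (tfun f (D t)))%:E)%E).
Proof.
move=> _ _ _ cD bD rkC rkD; split=> [maj f ndf cf f0 rho grho|].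
  exact: (uinorm_le_of_wmaj cD bD rkC rkD maj).
exact: wmaj_of_uinorm_le.
Qed.
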